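(* There exist a nonempty compact set $E \subset \mathbb{R}^2$ and $\varepsilon > 0$ such that every point of the boundary $\partial E_\varepsilon$ of the closed $\varepsilon$-neighbourhood $E_\varepsilon$ of $E$ is either a wedge or a shallow singularity. In particular, no subset of $\partial E_\varepsilon$ is diffeomorphic to a $C^1$-smooth curve.
   Context: For $E \subset \mathbb{R}^2$ and $\varepsilon > 0$, the closed $\varepsilon$-neighbourhood of $E$ is $E_\varepsilon := \overline{\bigcup_{x \in E} B_\varepsilon(x)}$, where $B_\varepsilon(x)$ is the open Euclidean ball of radius $\varepsilon$ centred at $x$ and the overline denotes closure. A boundary point $x \in \partial E_\varepsilon$ is smooth if there exist $\delta > 0$ and a $C^1$-curve $\Gamma$ with $\Gamma = \partial E_\varepsilon \cap \overline{B_\delta(x)}$; if $x$ is not smooth, it is called a singularity. The tangential directions of $\partial E_\varepsilon$ at $x \in \partial E_\varepsilon$ are the unit vectors that arise as limits of $(x_n - x)/\|x_n - x\|$ for sequences $x_n \in \partial E_\varepsilon \setminus \{x\}$ with $x_n \to x$. A singularity $x \in \partial E_\varepsilon$ is a wedge if there are exactly two tangential directions at $x$ and the angle $\theta$ between them satisfies $\theta \in (0, \pi)$. A singularity $x \in \partial E_\varepsilon$ is a shallow singularity if the tangential directions at $x$ are exactly two opposite vectors $u, -u$ (so $\partial E_\varepsilon$ has a tangent line at $x$) and $x$ is an accumulation point of wedges of $\partial E_\varepsilon$ (from one side or from both sides along the boundary). A $C^1$-smooth curve means a nondegenerate (not a single point) regular curve, i.e. the image of an interval of positive length under an injective $C^1$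 map with nowhere vanishing derivative. The last sentence of the claim means that no subset of $\partial E_\varepsilon$ is such a curve. *)

(* Defs.v *)
From HB Require Import structures.
From mathcomp Require Import all_boot all_order all_algebra.
From mathcomp Require Import all_classical all_reals all_analysis.

Set Implicit Arguments.
Unset Strict Implicit.
Unset Printing Implicit Defensive.

Import Order.TTheory GRing.Theory Num.Theory.
Import numFieldNormedType.Exports.

Local Open Scope classical_set_scope.
Local Open Scope ring_scope.

(* The norm that the library puts on 'rV[R]_2 is the sup norm, so the Euclidean
   one is defined here. The two are equivalent, so the library's topology on
   'rV[R]_2 (closure, interior, compact, limits) is the usual one. *)
Definition dotp (R : realType) (u v : 'rV[R]_2) : R :=
  \sum_(i < 2) u ord0 i * v ord0 i.

Definition enorm (R : realType) (u : 'rV[R]_2) : R := Num.sqrt (dotp u u).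

Definition eball (R : realType) (x : 'rV[R]_2) (r : R) : set 'rV[R]_2 :=
  [set y | enorm (y - x) < r].

Definition angle (R : realType) (u v : 'rV[R]_2) : R :=
  acos (dotp u v / (enorm u * enorm v)).

Definition boundary (T : topologicalType) (A : set T) : set T :=
  closure A `\` interior A.

Definition eps_neighbourhood (R : realType) (E : set 'rV[R]_2) (eps : R) :
    set 'rV[R]_2 :=
  closure (\bigcup_(x in E) eball x eps).

(* [I] is any interval with at least two points: open, closed or half-open,
   bounded or not. The derivative [dg] of [g] is taken relatively to [I], hence
   is one-sided at an endpoint belonging to [I]. *)
Definition C1_curve (R : realType) (C : set 'rV[R]_2) : Prop :=
  exists (I : set R) (g dg : R -> 'rV[R]_2),
    [/\ is_interval I /\ (exists a b, [/\ I a, I b & a < b]),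
        set_inj I g,
        forall t, I t ->
          (s - t)^-1 *: (g s - g t) @[s --> within I t^'] --> dg t,
        {within I, continuous dg} /\ (forall t, I t -> dg t != 0)
      & C = g @` I].

(* In what follows [B] is meant to be the boundary of an eps-neighbourhood. *)

Definition smooth_point (R : realType) (B : set 'rV[R]_2) (x : 'rV[R]_2) :
    Prop :=
  B x /\ exists delta : R, 0 < delta /\
    exists C : set 'rV[R]_2, C1_curve C /\ C = B `&` closure (eball x delta).

Definition singularity (R : realType) (B : set 'rV[R]_2) (x : 'rV[R]_2) :
    Prop :=
  B x /\ ~ smooth_point B x.

Definition tangential_directions (R : realType) (B : set 'rV[R]_2)
    (x : 'rV[R]_2) : set 'rV[R]_2 :=
  [set v | enorm v = 1 /\
     exists y : nat -> 'rV[R]_2,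
       [/\ forall n, (B `\ x) (y n),
           y n @[n --> \oo] --> x
         & (enorm (y n - x))^-1 *: (y n - x) @[n --> \oo] --> v]].

Definition wedge (R : realType) (B : set 'rV[R]_2) (x : 'rV[R]_2) : Prop :=
  singularity B x /\
  exists u v : 'rV[R]_2,
    [/\ u != v, tangential_directions B x = [set u; v] & 0 < angle u v < pi].

Definition shallow_singularity (R : realType) (B : set 'rV[R]_2)
    (x : 'rV[R]_2) : Prop :=
  [/\ singularity B x,
      exists u : 'rV[R]_2, tangential_directions B x = [set u; - u]
    & limit_point [set y | wedge B y] x].

(* Main.v *)
(* Let [H x] be the sum of [|x . v n|] over a summable sequence of vectors
    [v n] whose directions are dense, and let [K] be the set of all [x] with
    [|x|^2 - H x <= 1]. Since [H] is a supremum of linear forms [p . x], the set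
    [K] is a union of discs [|x - p/2|^2 <= 1 + |p|^2/4] of radius at least 1,
    so [K] is the closed 1-neighbourhood of the set [E] of the centres of the
    unit discs it contains. The boundary of [K] is the curve [|x|^2 - H x = 1],
    which meets each ray from the origin once. As [H] is convex, this curve has
    two one-sided tangents at each point; they form a proper angle exactly where
    [H] has a kink transversally to the ray, in particular wherever the curve
    crosses a line orthogonal to some [v n], and such points are dense. A
    C^1 curve in the boundary would cross such a line at an interior parameter,
    where its velocity and the opposite vector would both be tangential. *)

Require Import Defs.
From HB Require Import structures.
From mathcomp Require Import all_boot all_order all_algebra.
From mathcomp Require Import all_classical all_reals all_analysis.
From mathcomp Require Import ring lra.
Import Order.TTheory GRing.Theory Num.Theory.
Import numFieldNormedType.Exports.
Local Open Scope classical_set_scope.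
Local Open Scope ring_scope.

Lemma cvg_to_within {T U : Type} {F : set_system T} {FF : Filter F}
    (G : set_system U) (D : set U) (f : T -> U) :
  (\forall n \near F, D (f n)) -> f @ F `=>` G -> f @ F `=>` within D G.
Proof. by move=> fD fG P GP; apply: filterS2 fD (fG _ GP) => n Dn; exact. Qed.

(** * Euclidean geometry of the plane *)

Section plane.
Context {R : realType}.
Implicit Types (x y z u v w k : 'rV[R]_2) (a b t : R).

Lemma dotpE u v :
  dotp u v = u ord0 ord0 * v ord0 ord0 + u ord0 ord_max * v ord0 ord_max.
Proof.
rewrite /dotp !big_ord_recl big_ord0 addr0.
by congr (_ + u _ _ * v _ _); apply: val_inj.
Qed.

Lemma rV2P u v : u ord0 ord0 = v ord0 ord0 -> u ord0 ord_max = v ord0 ord_max ->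
  u = v.
Proof.
move=> e0 e1; apply/rowP => i.
have [->|/eqP i0] := eqVneq i ord0; first exact: e0.
suff -> : i = ord_max by exact: e1.
by apply: val_inj; case: i i0 => -[|[|]]//= ? []; exact: val_inj.
Qed.

Lemma dotpC u v : dotp u v = dotp v u.
Proof. by rewrite !dotpE; ring. Qed.

Lemma dotpDl u v w : dotp (u + v) w = dotp u w + dotp v w.
Proof. by rewrite !dotpE !mxE; ring. Qed.

Lemma dotpZl a u w : dotp (a *: u) w = a * dotp u w.
Proof. by rewrite !dotpE !mxE; ring. Qed.

Lemma dotpNl u w : dotp (- u) w = - dotp u w.
Proof. by rewrite !dotpE !mxE; ring. Qed.

Lemma dotpDr u v w : dotp w (u + v) = dotp w u + dotp w v.
Proof. by rewrite !dotpE !mxE; ring. Qed.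

Lemma dotpZr a u w : dotp w (a *: u) = a * dotp w u.
Proof. by rewrite !dotpE !mxE; ring. Qed.

Lemma dotpNr u w : dotp w (- u) = - dotp w u.
Proof. by rewrite !dotpE !mxE; ring. Qed.

Lemma dotp0l u : dotp 0 u = 0.
Proof. by rewrite !dotpE !mxE; ring. Qed.

Definition dotp_lin := (dotpDl, dotpDr, dotpZl, dotpZr, dotpNl, dotpNr).

Lemma dotp_ge0 u : 0 <= dotp u u.
Proof. by rewrite dotpE -!expr2 addr_ge0 ?sqr_ge0. Qed.

Lemma dotp_eq0 u : (dotp u u == 0) = (u == 0).
Proof.
apply/idP/eqP => [|->]; last by rewrite dotp0l.
rewrite dotpE -!expr2 paddr_eq0 ?sqr_ge0// !sqrf_eq0 => /andP[/eqP u0 /eqP u1].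
by apply: rV2P; rewrite mxE.
Qed.

Lemma dotp_gt0 u : (0 < dotp u u) = (u != 0).
Proof. by rewrite lt_neqAle dotp_ge0 andbT eq_sym dotp_eq0. Qed.

(** The anticlockwise quarter turn, so [dotp (perp u) v] is the determinant of [u] and [v]. *)
Definition perp x : 'rV[R]_2 :=
  \row_i (if i == ord0 then - x ord0 ord_max else x ord0 ord0).

Lemma dotp_perp x : dotp x (perp x) = 0.
Proof. by rewrite dotpE !mxE /=; ring. Qed.

Lemma dotp_perp2 x : dotp (perp x) (perp x) = dotp x x.
Proof. by rewrite !dotpE !mxE /=; ring. Qed.

Lemma perp_eq0 x : (perp x == 0) = (x == 0).
Proof. by rewrite -dotp_eq0 dotp_perp2 dotp_eq0. Qed.

(** Lagrange's identity. It gives Cauchy-Schwarz, and strictly so when the determinant is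
    nonzero. *)
Lemma dotp_pythagoras u v :
  dotp u v ^+ 2 + dotp (perp u) v ^+ 2 = dotp u u * dotp v v.
Proof. by rewrite !dotpE !mxE /=; ring. Qed.

Lemma perp_decomp x y :
  dotp x x *: y = dotp y x *: x + dotp y (perp x) *: perp x.
Proof. by apply: rV2P; rewrite !dotpE !mxE /=; ring. Qed.

Lemma dotp_le_enorm u v : dotp u v <= enorm u * enorm v.
Proof.
rewrite (le_trans (ler_norm _))// -sqrtr_sqr /enorm -sqrtrM ?dotp_ge0//.
by apply: ler_wsqrtr; rewrite -dotp_pythagoras lerDl sqr_ge0.
Qed.

Lemma enorm_ge0 u : 0 <= enorm u.
Proof. exact: sqrtr_ge0. Qed.

Lemma enorm_sqr u : enorm u ^+ 2 = dotp u u.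
Proof. by rewrite sqr_sqrtr ?dotp_ge0. Qed.

Lemma enorm_eq0 u : (enorm u == 0) = (u == 0).
Proof. by rewrite -sqrf_eq0 enorm_sqr dotp_eq0. Qed.

Lemma enorm_gt0 u : (0 < enorm u) = (u != 0).
Proof. by rewrite lt_neqAle enorm_ge0 andbT eq_sym enorm_eq0. Qed.

Lemma enorm0 : enorm (0 : 'rV[R]_2) = 0.
Proof. by apply/eqP; rewrite enorm_eq0. Qed.

Lemma enormZ a u : enorm (a *: u) = `|a| * enorm u.
Proof.
by rewrite /enorm !dotp_lin mulrA -expr2 sqrtrM ?sqr_ge0// sqrtr_sqr.
Qed.

Lemma enormN u : enorm (- u) = enorm u.
Proof. by rewrite /enorm !dotp_lin opprK. Qed.

Lemma enormD u v : enorm (u + v) <= enorm u + enorm v.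
Proof.
rewrite -(@ler_pXn2r _ 2)// ?nnegrE ?addr_ge0 ?enorm_ge0//.
rewrite sqrrD !enorm_sqr !dotp_lin (dotpC v u).
by have := dotp_le_enorm u v; lra.
Qed.

Lemma enorm_normalize u : u != 0 -> enorm ((enorm u)^-1 *: u) = 1.
Proof.
move=> u0; rewrite enormZ ger0_norm ?invr_ge0 ?enorm_ge0//.
by rewrite mulVf// enorm_eq0.
Qed.

Section cvg.
Context {T : Type} {F : set_system T} {FF : Filter F}.
Implicit Types f g : T -> 'rV[R]_2.

Lemma cvg_coord f x i : f @ F --> x -> f t ord0 i @[t --> F] --> x ord0 i.
Proof.
by move=> fx; exact: (cvg_comp _ (fun M : 'rV[R]_2 => M ord0 i) fx
  (@coord_continuous _ _ _ _ _ x)).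
Qed.

Lemma cvg_dotp f g x y : f @ F --> x -> g @ F --> y ->
  dotp (f t) (g t) @[t --> F] --> dotp x y.
Proof.
move=> fx gy; under eq_fun do rewrite dotpE; rewrite dotpE.
by apply: cvgD; apply: cvgM; exact: cvg_coord.
Qed.

Lemma cvg_enorm f x : f @ F --> x -> enorm (f t) @[t --> F] --> enorm x.
Proof.
by move=> fx; exact: (cvg_comp _ Num.sqrt (cvg_dotp _ _ _ _ fx fx)
  (@sqrt_continuous _ _)).
Qed.

Lemma cvg_normalize f x : x != 0 -> f @ F --> x ->
  (enorm (f t))^-1 *: f t @[t --> F] --> (enorm x)^-1 *: x.
Proof.
move=> x0 fx; apply: cvgZ => //.
by apply: cvgV; [rewrite enorm_eq0|exact: cvg_enorm].
Qed.
End cvg.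

End plane.

(** * Seminorms with kinks along densely many lines *)

Section kinked_seminorm.
Context {R : realType}.
Implicit Types (x y z u w k : 'rV[R]_2) (v : nat -> 'rV[R]_2) (a : nat -> R).

Definition sumR a : R := limn (series a).
(** A geometric majorant, unlike plain convergence, passes to every sequence that is termwise
    smaller in absolute value. *)
Definition dominated a := exists M : R, forall n, `|a n| <= geometric M 2^-1 n.

Lemma dominated_cvg a : dominated a -> cvgn (series a).
Proof.
move=> [M aM]; apply: normed_cvg.
apply: (series_le_cvg _ _ aM) => [n|n|].
- exact: normr_ge0.
- exact: le_trans (aM n).
- apply: is_cvg_geometric_series.
  by rewrite ger0_norm ?invr_ge0// invf_lt1// ltr1n.
Qed.

Lemma dominatedD a b : dominated a -> dominated b -> dominated (a + b).
Proof.
move=> [M aM] [N bN]; exists (M + N) => n.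
rewrite (le_trans (ler_normD _ _))//=.
by rewrite mulrDl lerD.
Qed.

Lemma dominatedZ c a : dominated a -> dominated (c *: a).
Proof.
move=> [M aM]; exists (`|c| * M) => n; rewrite [_ n]/(c * a n) normrM /=.
by rewrite -mulrA ler_wpM2l//; exact: aM.
Qed.

Lemma dominated_le a b : (forall n, `|a n| <= `|b n|) ->
  dominated b -> dominated a.
Proof. by move=> ab [M bM]; exists M => n; exact: le_trans (bM n). Qed.

Lemma sumRD a b : dominated a -> dominated b -> sumR (a + b) = sumR a + sumR b.
Proof. by move=> /dominated_cvg ca /dominated_cvg cb; exact: lim_seriesD. Qed.

Lemma sumRZ c a : dominated a -> sumR (c *: a) = c * sumR a.
Proof. by move=> /dominated_cvg ca; exact: lim_seriesZ. Qed.

Lemma sumR_le a b : dominated a -> dominated b -> (forall n, a n <= b n) ->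
  sumR a <= sumR b.
Proof. by move=> /dominated_cvg ca /dominated_cvg cb; exact: lim_series_le. Qed.

Lemma sumR_ge_term a n : dominated a -> (forall m, 0 <= a m) -> a n <= sumR a.
Proof.
move=> /dominated_cvg ca a0.
have -> : a n = series a n.+1 - series a n by rewrite seriesSr addrC addKr.
apply: (@le_trans _ _ (series a n.+1)).
  by rewrite lerBlDr lerDl; exact: sumr_ge0.
apply: nondecreasing_cvgn_le => //; apply/nondecreasing_seqP => m.
by rewrite seriesSr lerDl.
Qed.

(** The support function of the Minkowski sum of the segments from [- v n] to [v n]. *)
Definition gauge v x : R := sumR (fun n => `|dotp x (v n)|).

Definition dominated_seq v :=
  forall n i, `|v n ord0 i| <= geometric 1 2^-1 n.

(** All that the geometry below uses of [H]. The third clause gives subgradients; the fourth gives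
    the kinks, since it bounds a second difference below by a term of first order in [y]. *)
Variant gauge_spec v (H : 'rV[R]_2 -> R) : Prop := GaugeSpec of
  (forall x y, H (x + y) <= H x + H y) &
  (forall c x, H (c *: x) = `|c| * H x) &
  (forall x, exists2 p, dotp p x = H x & forall y, dotp p y <= H y) &
  (forall n x y, dotp x (v n) = 0 ->
    2 * `|dotp y (v n)| <= H (x + y) + H (x - y) - 2 * H x).

Lemma gaugeP v : dominated_seq v -> gauge_spec v (gauge v).
Proof.
move=> hv.
have dco i : dominated (fun n => v n ord0 i) by exists 1 => n; exact: hv.
have dd x : dominated (fun n => dotp x (v n)).
  have -> : (fun n => dotp x (v n)) = x ord0 ord0 *: (fun n => v n ord0 ord0) +
      x ord0 ord_max *: (fun n => v n ord0 ord_max).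
    by apply/funext => n; rewrite dotpE.
  by apply: dominatedD; exact: dominatedZ.
have da x : dominated (fun n => `|dotp x (v n)|).
  by apply: dominated_le (dd x) => n; rewrite normr_id.
split.
- move=> x y; rewrite /gauge -sumRD//; apply: sumR_le => //.
    exact: dominatedD.
  by move=> n; rewrite dotpDl [leRHS]/(_ + _) ler_normD.
- move=> c x; rewrite /gauge -sumRZ//; congr sumR; apply/funext => n.
  by rewrite dotpZl normrM.
- move=> x.
  (* Weighting each [v n] by the sign of [dotp x (v n)] gives the subgradient; for terms orthogonal
     to [x] any weight in [-1, 1] would do, and [Num.sg] takes 0. *)
  pose s i n := Num.sg (dotp x (v n)) * v n ord0 i.
  have ds i : dominated (s i).
    apply: dominated_le (dco i) => n; rewrite normrM ler_piMl//.
    by rewrite normr_sg; case: (_ != _).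
  have E y : dotp (\row_i sumR (s i)) y =
      sumR (fun n => Num.sg (dotp x (v n)) * dotp y (v n)).
    rewrite dotpE !mxE !(mulrC (sumR _)) -!sumRZ// -sumRD; last 2 first.
    - exact: dominatedZ.
    - exact: dominatedZ.
    congr sumR; apply/funext => n.
    rewrite -[LHS]/(y ord0 ord0 * s ord0 n + y ord0 ord_max * s ord_max n).
    by rewrite /s (dotpE y); ring.
  exists (\row_i sumR (s i)).
    by rewrite E; congr sumR; apply/funext => n; rewrite normrEsg.
  move=> y; rewrite E; have le1 n :
      `|Num.sg (dotp x (v n)) * dotp y (v n)| <= `|dotp y (v n)|.
    by rewrite normrM ler_piMl// normr_sg; case: (_ != _).
  apply: sumR_le => //; first exact: dominated_le (dd y).
  by move=> n; rewrite (le_trans (ler_norm _)).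
- move=> n x y xn.
  pose a : nat -> R := fun m => `|dotp (x + y) (v m)|.
  pose b : nat -> R := fun m => `|dotp (x - y) (v m)|.
  pose c : nat -> R := fun m => `|dotp x (v m)|.
  have [dA dB dC] : [/\ dominated a, dominated b & dominated c].
    by split; exact: da.
  have dAB : dominated (a + b) by exact: dominatedD.
  have dC2 : dominated (- 2 *: c) by exact: dominatedZ.
  have -> : gauge v (x + y) + gauge v (x - y) - 2 * gauge v x =
      sumR (a + b + (- 2) *: c).
    by rewrite sumRD// sumRD// sumRZ// mulNr.
  have abcE m : (a + b + (- 2) *: c) m = `|dotp x (v m) + dotp y (v m)| +
      `|dotp x (v m) - dotp y (v m)| - 2 * `|dotp x (v m)|.
    by rewrite -[LHS]/(a m + b m + - 2 * c m) /a /b /c !dotp_lin mulNr.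
  have -> : 2 * `|dotp y (v n)| = (a + b + (- 2) *: c) n.
    by rewrite abcE xn !add0r normr0 normrN mulr0 subr0 mulr_natl.
  (* All terms of the second difference are nonnegative by the triangle inequality, and the [n]-th
     one is the bound. *)
  apply: sumR_ge_term; first exact: dominatedD.
  move=> m; rewrite abcE.
  have := ler_normD (dotp x (v m) + dotp y (v m)) (dotp x (v m) - dotp y (v m)).
  have -> : dotp x (v m) + dotp y (v m) + (dotp x (v m) - dotp y (v m)) =
    2 * dotp x (v m) by ring.
  by rewrite normrM ger0_norm//; lra.
Qed.

(** Density of directions in the form used later: separation by a line through the origin is stable
    under small turns of the line. *)
Definition dense_directions v :=
  forall z1 z2 w, dotp w z1 < 0 -> 0 < dotp w z2 ->
    exists n, dotp z1 (v n) < 0 /\ 0 < dotp z2 (v n).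

(** The [v n] are the rational vectors, scaled by positive factors that preserve the signs of inner
    products and make the coordinates at most [2^-n]. *)
Lemma dense_directionsP : exists v, dominated_seq v /\ dense_directions v.
Proof.
(* Where [unpickle] fails, the pair (0, 0) makes [v n] zero, which respects the bound. *)
pose q n : rat * rat := odflt (0, 0) (unpickle n).
pose c n : R := (2^-1) ^+ n / (1 + `|ratr (q n).1| + `|ratr (q n).2|).
pose v n : 'rV[R]_2 :=
  c n *: \row_i (if i == ord0 then ratr (q n).1 else ratr (q n).2).
have den n : 0 < 1 + `|ratr (q n).1| + `|ratr (q n).2| :> R.
  by rewrite -addrA ltr_wpDr// addr_ge0.
have c0 n : 0 < c n by rewrite divr_gt0// exprn_gt0// invr_gt0.
exists v; split.
  move=> n i; rewrite !mxE normrM gtr0_norm// /c /geometric /=.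
  rewrite mul1r -mulrA ler_piMr ?exprn_ge0 ?invr_ge0//.
  rewrite mulrC ler_pdivrMr// mul1r.
  have := normr_ge0 (ratr (q n).1 : R); have := normr_ge0 (ratr (q n).2 : R).
  by case: ifP => _; lra.
move=> z1 z2 w w1 w2.
pose M := `|z1 ord0 ord0| + `|z1 ord0 ord_max| + `|z2 ord0 ord0| +
  `|z2 ord0 ord_max| + 1.
have M0 : 0 < M by rewrite ltr_pwDr// !addr_ge0.
(* Moving the coordinates of [w] by less than [e] changes its products with [z1] and [z2] by less
   than [e * M], the smaller margin. *)
pose e := Num.min (- dotp w z1) (dotp w z2) / M.
have e0 : 0 < e by rewrite divr_gt0// lt_min oppr_gt0 w1 w2.
have [r0 r0P] : exists r, ratr r \in `]w ord0 ord0, w ord0 ord0 + e[.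
  by apply: rat_in_itvoo; rewrite ltrDl.
have [r1 r1P] : exists r, ratr r \in `]w ord0 ord_max, w ord0 ord_max + e[.
  by apply: rat_in_itvoo; rewrite ltrDl.
exists (pickle (r0, r1)).
pose d : 'rV[R]_2 := \row_i (if i == ord0 then ratr r0 else ratr r1) - w.
have vE z : dotp z (v (pickle (r0, r1))) =
    c (pickle (r0, r1)) * (dotp w z + dotp d z).
  by rewrite /v !dotpE !mxE /q pickleK /=; ring.
have small (a b a' b' : R) : 0 < a < e -> 0 < b < e ->
    `|a'| + `|b'| + 1 <= M -> `|a * a' + b * b'| < e * M.
  move=> /andP[a0 ae] /andP[b0 be] le.
  rewrite (le_lt_trans (ler_normD _ _))// !normrM (gtr0_norm a0) (gtr0_norm b0).
  rewrite (@lt_le_trans _ _ (e * (`|a'| + `|b'| + 1)))//; last first.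
    by rewrite ler_pM2l.
  have := ler_wpM2r (normr_ge0 a') (ltW ae).
  by have := ler_wpM2r (normr_ge0 b') (ltW be); lra.
have eM : e * M = Num.min (- dotp w z1) (dotp w z2) by rewrite divfK// gt_eqF.
move: r0P r1P; rewrite !in_itv/= => /andP[? ?] /andP[? ?].
have D z : `|z ord0 ord0| + `|z ord0 ord_max| + 1 <= M ->
    `|dotp d z| < Num.min (- dotp w z1) (dotp w z2).
  by move=> zM; rewrite -eM dotpE !mxE /=; apply: small => //; lra.
have := normr_ge0 (z1 ord0 ord0); have := normr_ge0 (z1 ord0 ord_max).
have := normr_ge0 (z2 ord0 ord0); have := normr_ge0 (z2 ord0 ord_max).
move=> ? ? ? ?.
have /D : `|z1 ord0 ord0| + `|z1 ord0 ord_max| + 1 <= M by rewrite /M; lra.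
have /D : `|z2 ord0 ord0| + `|z2 ord0 ord_max| + 1 <= M by rewrite /M; lra.
rewrite !lt_min !ltr_norml => /andP[_ /andP[? _]] /andP[/andP[_ ?] _].
rewrite !vE; split.
  by rewrite pmulr_rlt0//; lra.
by rewrite pmulr_rgt0//; lra.
Qed.

End kinked_seminorm.

(** * Tangential directions of regular curves *)

Section curves.
Context {R : realType}.
Implicit Types (g dg : R -> 'rV[R]_2) (I : set R) (B : set 'rV[R]_2).

Lemma diff_within_continuous I g t (d : 'rV[R]_2) :
  (s - t)^-1 *: (g s - g t) @[s --> within I t^'] --> d ->
  g @ within I (nbhs t) --> g t.
Proof.
move=> gd; have gt : g s @[s --> within I t^'] --> g t.
  apply: (@cvg_trans _ (g t + (s - t) *: ((s - t)^-1 *: (g s - g t))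
      @[s --> within I t^'])).
    apply: near_eq_cvg; near=> s.
    have st : s != t.
      by near: s; apply: cvg_within; exact: withinT.
    by rewrite scalerA divff ?subr_eq0// scale1r subrKC.
  rewrite [X in _ `=>` nbhs X](_ : _ = g t + (t - t) *: d); last first.
    by rewrite subrr scale0r addr0.
  apply: cvgD; first exact: cvg_cst.
  apply: cvgZ => //; apply: cvgB; last exact: cvg_cst.
  by move=> P tP; apply: cvg_within; exact: (cvg_within _ tP).
move=> P Pgt.
have gtP : \forall s \near t, s != t -> I s -> P (g s) := gt _ Pgt.
suff : \forall s \near t, I s -> P (g s) by [].
apply: filterS gtP => s h Is.
have [->|st] := eqVneq s t; first exact: nbhs_singleton.
exact: h.
Unshelve. all: by end_near. Qed.

(** The sign [e] chooses the side from which the parameter tends to [t], so an interior parameter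
    yields two opposite tangential directions. *)
Lemma curve_tangential B I g t (d : 'rV[R]_2) (e : R) : e ^+ 2 = 1 ->
  {in I &, injective g} -> g @` I `<=` B -> d != 0 ->
  (s - t)^-1 *: (g s - g t) @[s --> within I t^'] --> d ->
  (exists2 r, 0 < r & forall s, `|s - t| <= r -> I s) ->
  tangential_directions B (g t) (e *: ((enorm d)^-1 *: d)).
Proof.
move=> e2 ginj gB d0 gd [r r0 rI].
have e1 : `|e| = 1 by rewrite -sqrtr_sqr e2 sqrtr1.
have e0 : e != 0 by rewrite -normr_eq0 e1 oner_eq0.
have It : I t by apply: rI; rewrite subrr normr0 ltW.
split; first by rewrite enormZ e1 mul1r enorm_normalize.
(* As [harmonic n] is [1 / (n + 1)], all [s n] are within [r] of [t]. *)
pose s n := t + e * (r * harmonic n).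
have st n : s n - t = e * (r * harmonic n) by rewrite /s addrC addKr.
have h0 n := @harmonic_gt0 R n.
have rh0 n : 0 < r * harmonic n by rewrite mulr_gt0.
have Is n : I (s n).
  apply: rI; rewrite st normrM e1 mul1r gtr0_norm// ler_piMr ?(ltW r0)//.
  by rewrite /harmonic /= invf_le1 ?ler1n// ltr0n.
have snt n : s n != t.
  by rewrite -subr_eq0 st mulf_neq0// lt0r_neq0.
have s_cvg : s n @[n --> \oo] --> t.
  rewrite -[X in _ --> X]addr0 -(mulr0 e) -(mulr0 r).
  apply: cvgD; first exact: cvg_cst.
  by do 2! (apply: cvgM; first exact: cvg_cst); exact: cvg_harmonic.
have s_within : s n @[n --> \oo] `=>` within I t^'.
  apply: cvg_to_within; first exact: nearW.
  by apply: cvg_to_within s_cvg; exact: nearW.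
exists (fun n => g (s n)); split.
- move=> n; split; first by apply: gB; exists (s n).
  by move=> /ginj e'; move: (snt n); rewrite e' ?eqxx// mem_set.
- have s_within' : s n @[n --> \oo] `=>` within I (nbhs t).
    by apply: cvg_to_within => //; exact: nearW.
  exact: (cvg_comp _ _ s_within' (diff_within_continuous _ _ _ _ gd)).
- pose q u := (u - t)^-1 *: (g u - g t).
  have qd : q (s n) @[n --> \oo] --> d := cvg_comp _ _ s_within gd.
  (* Normalizing cancels the size of [s n - t] and leaves its sign [e]. *)
  have E n : (enorm (g (s n) - g t))^-1 *: (g (s n) - g t) =
      e *: ((enorm (q (s n)))^-1 *: q (s n)).
    have -> : g (s n) - g t = (s n - t) *: q (s n).
      by rewrite /q scalerA divff ?subr_eq0// scale1r.
    rewrite enormZ !scalerA st normrM e1 mul1r gtr0_norm// invfM.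
    congr (_ *: _); have := lt0r_neq0 (rh0 n).
    by move: (r * _) (enorm _)^-1 => rh c rhn0; field; rewrite rhn0.
  under eq_fun do rewrite E.
  by apply: cvgZ; [exact: cvg_cst|exact: cvg_normalize].
Qed.

End curves.

(** * Elementary properties of the seminorm *)

Section body.
Context {R : realType} {v : nat -> 'rV[R]_2} {H : 'rV[R]_2 -> R}.
Context (HP : gauge_spec v H).
Implicit Types (x y z u w k : 'rV[R]_2) (a b s t : R).

Lemma gaugeD x y : H (x + y) <= H x + H y.
Proof. by case: HP. Qed.

Lemma gaugeZ a x : H (a *: x) = `|a| * H x.
Proof. by case: HP. Qed.

Lemma gauge_pZ a x : 0 <= a -> H (a *: x) = a * H x.
Proof. by move=> a0; rewrite gaugeZ ger0_norm. Qed.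

Lemma gaugeN x : H (- x) = H x.
Proof. by rewrite -scaleN1r gaugeZ normrN1 mul1r. Qed.

Lemma gauge0 : H 0 = 0.
Proof. by rewrite -(scale0r 0) gaugeZ normr0 mul0r. Qed.

Lemma gauge_ge0 x : 0 <= H x.
Proof. by have := gaugeD x (- x); rewrite subrr gauge0 gaugeN; lra. Qed.

Lemma gauge_support x : exists2 p, dotp p x = H x & forall y, dotp p y <= H y.
Proof. by case: HP. Qed.

Lemma gauge_kink n x y : dotp x (v n) = 0 ->
  2 * `|dotp y (v n)| <= H (x + y) + H (x - y) - 2 * H x.
Proof. by case: HP => _ _ _; exact. Qed.

(** A Lipschitz constant of [H] for the sum of the absolute values of the coordinates. *)
Definition gauge_bound : R :=
  H (\row_i (i == ord0)%:R) + H (\row_i (i == ord_max)%:R).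

Lemma gauge_bound_ge0 : 0 <= gauge_bound.
Proof. by rewrite addr_ge0// gauge_ge0. Qed.

Lemma gauge_le x : H x <= gauge_bound * (`|x ord0 ord0| + `|x ord0 ord_max|).
Proof.
have E : x = x ord0 ord0 *: (\row_i (i == ord0)%:R) +
             x ord0 ord_max *: (\row_i (i == ord_max)%:R).
  by apply: rV2P; rewrite !mxE /=; ring.
rewrite {1}E (le_trans (gaugeD _ _))// !gaugeZ /gauge_bound.
have := gauge_ge0 (\row_i (i == ord0)%:R).
have := gauge_ge0 (\row_i (i == ord_max)%:R).
move: (H _) (H _) => a b a0 b0.
have := mulr_ge0 (normr_ge0 (x ord0 ord0)) a0.
have := mulr_ge0 (normr_ge0 (x ord0 ord_max)) b0.
by lra.
Qed.

Lemma cvg_gauge {T : Type} {F : set_system T} {FF : Filter F}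
    (f : T -> 'rV[R]_2) x : f @ F --> x -> H (f t) @[t --> F] --> H x.
Proof.
move=> fx.
pose g (n : T) := gauge_bound *
  (`|f n ord0 ord0 - x ord0 ord0| + `|f n ord0 ord_max - x ord0 ord_max|).
have g0 : g n @[n --> F] --> 0.
  rewrite -[X in _ --> X](mulr0 gauge_bound) -[X in _ * X](addr0 0).
  apply: cvgM; first exact: cvg_cst.
  by apply: cvgD; rewrite -[X in _ --> X](@normr0 _ R); apply: cvg_norm;
    apply/subr_cvg0; exact: cvg_coord.
apply: (@squeeze_cvgr _ _ _ _ (fun n => H x - g n) (fun n => H x + g n)).
- apply: nearW => n.
  have gE y z : H y <= H z +
      gauge_bound * (`|(y - z) ord0 ord0| + `|(y - z) ord0 ord_max|).
    have := gaugeD z (y - z); rewrite addrC subrK.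
    by have := gauge_le (y - z); lra.
  have := gE (f n) x; have := gE x (f n); rewrite !mxE /g.
  by rewrite (distrC (x ord0 ord0)) (distrC (x ord0 ord_max)) => ? ?; lra.
- rewrite -[X in _ --> X]subr0; apply: cvgB => //; exact: cvg_cst.
- rewrite -[X in _ --> X]addr0; apply: cvgD => //; exact: cvg_cst.
Qed.

(** * The body, and its rim in polar form *)

Definition excess x := dotp x x - H x.
Definition body : set 'rV[R]_2 := [set x | excess x <= 1].
Definition rim : set 'rV[R]_2 := [set x | excess x = 1].

Lemma excessZ a x : 0 <= a -> excess (a *: x) = a ^+ 2 * dotp x x - a * H x.
Proof. by move=> a0; rewrite /excess gauge_pZ// !dotp_lin mulrA. Qed.

Lemma cvg_excess {T : Type} {F : set_system T} {FF : Filter F}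
    (f : T -> 'rV[R]_2) x : f @ F --> x -> excess (f t) @[t --> F] --> excess x.
Proof. by move=> fx; apply: cvgB; [exact: cvg_dotp|exact: cvg_gauge]. Qed.

Lemma rim_neq0 x : rim x -> x != 0.
Proof.
rewrite /rim /= /excess; apply: contra_eqN => /eqP ->.
by rewrite dotp0l gauge0 subr0 eq_sym oner_eq0.
Qed.

(* The positive root [r] of [r^2 |z|^2 - r H z = 1]. *)
Definition rim_radius z :=
  (H z + Num.sqrt (H z ^+ 2 + 4 * dotp z z)) / (2 * dotp z z).

Lemma rim_radius_gt0 z : z != 0 -> 0 < rim_radius z.
Proof.
rewrite -dotp_gt0 => z0; rewrite divr_gt0 ?mulr_gt0//.
by rewrite ltr_wpDl ?gauge_ge0// sqrtr_gt0 ltr_wpDl ?sqr_ge0// mulr_gt0.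
Qed.

Lemma rim_rim_radius z : z != 0 -> rim (rim_radius z *: z).
Proof.
move=> z0; rewrite /rim /= excessZ ?ltW ?rim_radius_gt0// /rim_radius.
have z2 : 0 <= H z ^+ 2 + 4 * dotp z z.
  by rewrite addr_ge0 ?sqr_ge0// mulr_ge0 ?dotp_ge0.
have := sqr_sqrtr z2; move: (Num.sqrt _) => q q2.
have N0 : dotp z z != 0 by rewrite dotp_eq0.
move: (dotp z z) N0 q2 => N N0 q2.
have -> : (H z + q) / (2 * N) = (H z + q) / 2 / N by field.
have : q ^+ 2 - H z ^+ 2 - 4 * N = 0 by rewrite q2; ring.
move: (H z) => h e.
apply/eqP; rewrite -subr_eq0; apply/eqP.
suff -> : ((h + q) / 2 / N) ^+ 2 * N - (h + q) / 2 / N * h - 1 =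
  (q ^+ 2 - h ^+ 2 - 4 * N) / (4 * N) by rewrite e mul0r.
by field.
Qed.

(** The quadratic equation for the radius has roots of opposite sign. Eliminating [H z] between the
    two instances leaves [a - b] times a positive factor. *)
Lemma rim_ray_inj a b z : 0 < a -> 0 < b -> rim (a *: z) -> rim (b *: z) ->
  a = b.
Proof.
move=> a0 b0; rewrite /rim /= !excessZ ?ltW// => ea eb.
have N0 := dotp_ge0 z.
have : (a - b) * (a * b * dotp z z + 1) = 0.
  have -> : (a - b) * (a * b * dotp z z + 1) =
      b * (a ^+ 2 * dotp z z - a * H z - 1) -
      a * (b ^+ 2 * dotp z z - b * H z - 1).
    by ring.
  by rewrite ea eb subrr !mulr0 subrr.
move=> /eqP; rewrite mulf_eq0 => /orP[|]; first by rewrite subr_eq0 => /eqP.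
have := mulr_ge0 (ltW (mulr_gt0 a0 b0)) N0.
by move=> ? /eqP; lra.
Qed.

Lemma rim_radiusE a z : 0 < a -> rim (a *: z) -> rim_radius z = a.
Proof.
move=> a0 az; have z0 : z != 0.
  by apply: contraTneq (rim_neq0 _ az) => ->; rewrite scaler0 eqxx.
exact: rim_ray_inj (rim_radius_gt0 _ z0) a0 (rim_rim_radius _ z0) az.
Qed.

Lemma rim_radius1 x : rim x -> rim_radius x = 1.
Proof. by move=> rx; apply: rim_radiusE; rewrite ?scale1r. Qed.

Lemma cvg_rim_radius {T : Type} {F : set_system T} {FF : Filter F}
    (f : T -> 'rV[R]_2) x : x != 0 -> f @ F --> x ->
  rim_radius (f t) @[t --> F] --> rim_radius x.
Proof.
move=> x0 fx; apply: cvgM.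
  apply: cvgD; first exact: cvg_gauge.
  apply: (cvg_comp _ Num.sqrt _ (@sqrt_continuous _ _)).
  apply: cvgD.
    under eq_fun do rewrite expr2; rewrite expr2.
    by apply: cvgM; exact: cvg_gauge.
  by apply: cvgM; [exact: cvg_cst|exact: cvg_dotp].
apply: cvgV; first by rewrite mulf_neq0// dotp_eq0.
by apply: cvgM; [exact: cvg_cst|exact: cvg_dotp].
Qed.

(** * The body as a closed unit neighbourhood *)

Lemma continuous_excess : continuous (excess).
Proof. by move=> x; exact: (cvg_excess (F := nbhs x) id x cvg_id). Qed.

Lemma closed_body : closed body.
Proof.
rewrite -[X in closed X]/(excess @^-1` [set t | t <= 1]).
apply: preimage_closed (@closed_le R 1) => x _.
exact: continuous_excess.
Qed.

(** Points of excess below 1 are interior by continuity; from a rim point any move outwards along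
    its ray raises the excess above 1. *)
Lemma boundary_body : boundary body = rim.
Proof.
rewrite /boundary -((closure_id _).1 closed_body).
apply/seteqP; split => x /=.
  move=> [xK] nint; apply/eqP; rewrite eq_le [X in X && _]xK /= leNgt.
  apply/negP => x1; apply: nint.
  have oU : open (excess @^-1` [set t | t < 1]).
    by apply: open_comp (@open_lt R 1) => y _; exact: continuous_excess.
  move: oU; rewrite openE => /(_ x x1); apply: filterS => y /=.
  exact: ltW.
move=> x1; split; first by rewrite /body /= x1.
rewrite /interior => nb.
have x0 := rim_neq0 _ x1.
have N0 : 0 < dotp x x by rewrite dotp_gt0.
have : (1 + t) *: x @[t --> (0 : R)^'+] --> x.
  rewrite -[X in _ --> X]scale1r -[X in X *: _](addr0 1).
  apply: cvgZr_tmp; apply: cvgD; first exact: cvg_cst.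
  exact/cvg_at_right_filter/cvg_id.
move=> /(_ _ nb) /= nbt.
near (0 : R)^'+ => t.
have t0 : 0 < t by [].
have : body ((1 + t) *: x) by near: t.
rewrite /body /= leNgt => /negP; apply.
rewrite excessZ//; last by rewrite addr_ge0// ltW.
move: x1; rewrite /rim /= /excess => x1.
have -> : H x = dotp x x - 1 by rewrite -x1; ring.
have -> : (1 + t) ^+ 2 * dotp x x - (1 + t) * (dotp x x - 1) =
  1 + t + t * (dotp x x + t * dotp x x) by ring.
have : 0 < t * (dotp x x + t * dotp x x).
  by rewrite mulr_gt0// addr_gt0// mulr_gt0.
by lra.
Unshelve. all: by end_near. Qed.

(* A subgradient [p] of [H] at [x] gives a disc of centre [p / 2] and radius
   [sqrt (1 + |p|^2 / 4) >= 1] that contains [x] and lies in the body. *)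
Lemma unit_disc_in_body x : body x ->
  exists2 e, eball e 1 `<=` body & enorm (x - e) <= 1.
Proof.
move=> xK; have [p px pH] := gauge_support x.
pose c := 2^-1 *: p; pose r := Num.sqrt (1 + dotp c c).
have r2 : r ^+ 2 = 1 + dotp c c by rewrite sqr_sqrtr// addr_ge0// dotp_ge0.
have r1 : 1 <= r.
  by rewrite -[leLHS]sqrtr1 ler_sqrt ?lerDl ?dotp_ge0// addr_ge0// dotp_ge0.
have r0 : 0 < r by lra.
have dE y : dotp (y - c) (y - c) = dotp y y - dotp p y + dotp c c.
  by rewrite /c !dotp_lin (dotpC y p); lra.
have xc : enorm (x - c) <= r.
  rewrite -(@ler_pXn2r _ 2)// ?nnegrE ?enorm_ge0 ?(ltW r0)// enorm_sqr r2 dE px.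
  by move: xK; rewrite /body /= /excess; lra.
(* The point at the fraction [1 / r] of the way from [x] to [c] is within 1 of [x] and within
   [r - 1] of [c], so its unit ball stays in the large disc. *)
exists (x + r^-1 *: (c - x)); last first.
  rewrite opprD addNKr enormN enormZ ger0_norm ?invr_ge0 ?(ltW r0)//.
  by rewrite -enormN opprB mulrC ler_pdivrMr// mul1r.
move=> y /= ye; rewrite /body /= /excess.
have yc : enorm (y - c) <= r.
  have -> : y - c = (y - (x + r^-1 *: (c - x))) + (1 - r^-1) *: (x - c).
    by apply: rV2P; rewrite !mxE; ring.
  rewrite (le_trans (enormD _ _))// enormZ ger0_norm; last first.
    by rewrite subr_ge0 invf_le1.
  have : (1 - r^-1) * enorm (x - c) <= (1 - r^-1) * r.
    by rewrite ler_wpM2l// subr_ge0 invf_le1.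
  have -> : (1 - r^-1) * r = r - 1 by rewrite mulrBl mul1r mulVf// gt_eqF.
  by move: ye; rewrite /eball /=; lra.
have := pH y; move: yc.
rewrite -(@ler_pXn2r _ 2)// ?nnegrE ?enorm_ge0 ?(ltW r0)// enorm_sqr r2 dE.
by lra.
Qed.

(** [|x|^2] outgrows [H], which is at most linear. *)
Lemma bounded_body : bounded_set body.
Proof.
exists (2 * gauge_bound + 1); split => [|M ltM x xK]; first exact: num_real.
have B0 := gauge_bound_ge0.
rewrite /Num.norm /= mx_normrE; apply/bigmax_leP; split => [|[i j] _] /=.
  by lra.
move: xK; rewrite /body /= /excess dotpE -!expr2 => xK.
suff : Num.max `|x ord0 ord0| `|x ord0 ord_max| <= 2 * gauge_bound + 1.
  rewrite ge_max => /andP[l0 l1]; rewrite (ord1 i).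
  have -> : x ord0 j = if j == ord0 then x ord0 ord0 else x ord0 ord_max.
    by case: ifPn => [/eqP->//|]; case: j => -[|[|]]//= ? _; congr (x _ _);
      exact: val_inj.
  by case: ifP => _; lra.
rewrite -(real_normK (num_real (x ord0 ord0))) in xK.
rewrite -(real_normK (num_real (x ord0 ord_max))) in xK.
move: xK (normr_ge0 (x ord0 ord0)) (normr_ge0 (x ord0 ord_max)) (gauge_le x).
move: `|x ord0 ord0| `|x ord0 ord_max| (H x) B0 => a b h B0 abh a0 b0 hB.
move: (gauge_bound) B0 hB => B B0 hB.
have far a' b' : 0 <= a' -> 2 * B + 1 < a' ->
    B * (a' + b') + 1 < a' ^+ 2 + b' ^+ 2.
  (* The product gives [a'^2 > B a' + 2 B^2 + 3 B + 1], the square [b'^2 >= B b' - B^2 / 4]. *)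
  move=> a'0 big; have : 0 < (a' - (2 * B + 1)) * (a' + B + 1).
    by rewrite mulr_gt0//; lra.
  have := sqr_ge0 (b' - B / 2); have := sqr_ge0 B; rewrite !expr2.
  by lra.
rewrite leNgt lt_max; apply/negP => /orP[] big.
  by have := far _ b a0 big; lra.
by have := far _ a b0 big; lra.
Qed.

Lemma body_is_neighbourhood :
  exists E : set 'rV[R]_2,
    [/\ E !=set0, compact E & eps_neighbourhood E 1 = body].
Proof.
pose E := [set e : 'rV[R]_2 | eball e 1 `<=` body].
have EK : E `<=` body.
  by move=> e; apply; rewrite /eball /= subrr enorm0.
exists E; split.
- have : body 0 by rewrite /body /= /excess dotp0l gauge0 subr0.
  by move=> /unit_disc_in_body[e eK _]; exists e.
- apply: bounded_closed_compact.
    have [M [Mr MK]] := bounded_body.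
    by exists M; split => // N /MK h x /EK; exact: h.
  (* Closedness: [E] is an intersection of translates of the body. *)
  have -> : E = \bigcap_(d in [set d | enorm d < 1]) [set e | body (e + d)].
    apply/seteqP; split => e /= h.
      by move=> d /= d1; apply: h; rewrite /eball /= addrC addKr.
    by move=> y y1; have := h _ y1; rewrite /= subrKC.
  apply: closed_bigI => d _.
  rewrite -[X in closed X]/((fun e => e + d) @^-1` body).
  by apply: preimage_closed closed_body => e _;
    exact: (cvgD (F := nbhs e) cvg_id (cvg_cst d)).
- rewrite /eps_neighbourhood; apply/seteqP; split.
    rewrite [X in _ `<=` X]((closure_id _).1 closed_body).
    by apply: closure_subset => y [e Ee ye]; exact: Ee.
  move=> x /unit_disc_in_body[e eK xe] U Ux.
  (* As [x] may lie on the unit circle around [e], it is approached from inside the disc. *)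
  have : x + t *: (e - x) @[t --> (0 : R)^'+] --> x.
    rewrite -[X in _ --> X]addr0 -(scale0r (e - x)).
    apply: cvgD; first exact: cvg_cst.
    by apply: cvgZr_tmp; exact/cvg_at_right_filter/cvg_id.
  move=> /(_ _ Ux) /= nbt.
  near (0 : R)^'+ => t.
  have t0 : 0 < t by [].
  have t1 : t < 1 by near: t; exact: nbhs_right_lt.
  exists (x + t *: (e - x)); split; last by near: t.
  exists e => //; rewrite /eball /=.
  have -> : x + t *: (e - x) - e = (1 - t) *: (x - e).
    by apply: rV2P; rewrite !mxE; ring.
  rewrite enormZ ger0_norm ?subr_ge0 ?(ltW t1)//.
  rewrite (@le_lt_trans _ _ (1 - t))// ?ltrBlDr ?ltrDl//.
  by rewrite ler_piMr// subr_ge0 ltW.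
Unshelve. all: by end_near. Qed.

(** * One-sided slopes of the radius *)

(* The one-sided derivative at [s = 0] of the radius [rim_radius (x + s *: k)],
   from differentiating [r^2 |x + s k|^2 - r H (x + s k) = 1] at [r = 1]. *)
Definition slope x k : R :=
  lim ((H (x + s *: k) - H x) / s @[s --> 0^'+]) / (dotp x x + 1).

(** By convexity the quotient is nondecreasing in [s], and it is at least [- H k]. *)
Lemma dirder_cvg x k : cvg ((H (x + s *: k) - H x) / s @[s --> 0^'+]).
Proof.
have sum_cvx s t : 0 < s -> s <= t ->
    (H (x + s *: k) - H x) / s <= (H (x + t *: k) - H x) / t.
  move=> s0 st; have t0 : 0 < t by exact: lt_le_trans st.
  rewrite ler_pdivrMr// mulrAC ler_pdivlMr//.
  have E : t *: (x + s *: k) = (t - s) *: x + s *: (x + t *: k).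
    by apply: rV2P; rewrite !mxE; ring.
  have := gaugeD ((t - s) *: x) (s *: (x + t *: k)).
  by rewrite -E !gauge_pZ ?subr_ge0 ?(ltW s0) ?(ltW t0)//; lra.
apply/cvg_ex; eexists.
apply: (@nondecreasing_at_right_cvgr _ _ _ (BInfty R false)) => //.
  by move=> s t; rewrite !in_itv/= !andbT => s0 _; exact: sum_cvx.
exists (- H k) => _ [s] + <- /=; rewrite set_interval.set_itvE => s0.
rewrite ler_pdivlMr//.
have := gaugeD (x + s *: k) (- (s *: k)).
by rewrite addrK gaugeN gauge_pZ ?(ltW s0)//; lra.
Qed.

(** The left side of [gauge_kink] at [s *: k] is linear in [s > 0], so the bound survives division
    by [s] and the limit. *)
Lemma slope_sum_ge x k n : dotp x (v n) = 0 ->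
  2 * `|dotp k (v n)| / (dotp x x + 1) <= slope x k + slope x (- k).
Proof.
move=> xn; have N0 := dotp_ge0 x.
rewrite /slope -mulrDl ler_pM2r ?invr_gt0; last by lra.
have c1 := dirder_cvg x k; have c2 := dirder_cvg x (- k).
rewrite -limD//.
apply: limr_ge; first exact: is_cvgD.
near=> s; have s0 : 0 < s by [].
rewrite -[leRHS]/((H (x + s *: k) - H x) / s +
  (H (x + s *: - k) - H x) / s) -mulrDl ler_pdivlMr//.
have := gauge_kink n x (s *: k) xn.
by rewrite dotpZl normrM gtr0_norm// scalerN; lra.
Unshelve. all: by end_near. Qed.

Lemma slope_sum_ge0 x k : 0 <= slope x k + slope x (- k).
Proof.
have N0 := dotp_ge0 x.
rewrite /slope -mulrDl mulr_ge0 ?invr_ge0//; last by lra.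
have c1 := dirder_cvg x k; have c2 := dirder_cvg x (- k).
rewrite -limD//.
apply: limr_ge; first exact: is_cvgD.
near=> s; have s0 : 0 < s by [].
rewrite -[leRHS]/((H (x + s *: k) - H x) / s +
  (H (x + s *: - k) - H x) / s) -mulrDl mulr_ge0 ?invr_ge0 ?(ltW s0)// scalerN.
have := gaugeD (x + s *: k) (x - s *: k).
have -> : x + s *: k + (x - s *: k) = 2 *: x by apply: rV2P; rewrite !mxE; ring.
by rewrite gaugeZ ger0_norm//; lra.
Unshelve. all: by end_near. Qed.

(** * One-sided tangents of the rim *)

(** The line through [x] along [k], projected radially onto the rim. *)
Definition chart x k s : 'rV[R]_2 := rim_radius (x + s *: k) *: (x + s *: k).

Lemma cvg_line {T : Type} {F : set_system T} {FF : Filter F} x k (f : T -> R) :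
  f @ F --> 0 -> x + f t *: k @[t --> F] --> x.
Proof.
move=> f0; rewrite -[X in _ --> X]addr0 -(scale0r k).
by apply: cvgD; [exact: cvg_cst|exact: cvgZr_tmp].
Qed.

Lemma cvg_chart {T : Type} {F : set_system T} {FF : Filter F} x k (f : T -> R) :
  rim x -> f @ F --> 0 -> chart x k (f t) @[t --> F] --> x.
Proof.
move=> rx f0; rewrite -[X in _ --> X](scale1r x) -(rim_radius1 _ rx).
apply: cvgZ; last exact: cvg_line.
by apply: cvg_rim_radius; [exact: rim_neq0|exact: cvg_line].
Qed.

Lemma line_neq0 x k s : x != 0 -> dotp x k = 0 -> x + s *: k != 0.
Proof.
rewrite -dotp_gt0 => x0 xk; rewrite -dotp_gt0 !dotp_lin (dotpC k) xk.
rewrite !mulr0 addr0 add0r ltr_wpDr// mulrA mulr_ge0 ?dotp_ge0//.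
by rewrite -expr2 sqr_ge0.
Qed.

Lemma chart_rim x k s : x != 0 -> dotp x k = 0 -> rim (chart x k s).
Proof. by move=> x0 xk; apply: rim_rim_radius; exact: line_neq0. Qed.

Lemma chart_neq x k s : x != 0 -> dotp x k = 0 -> k != 0 -> s != 0 ->
  chart x k s != x.
Proof.
move=> x0 xk k0 s0; apply/eqP => /(congr1 (dotp k)).
rewrite /chart !dotp_lin (dotpC k x) xk add0r => /eqP.
rewrite mulf_eq0 (gt_eqF (rim_radius_gt0 _ (line_neq0 _ _ s x0 xk))) /=.
by rewrite mulf_eq0 (negPf s0) dotp_eq0 (negPf k0).
Qed.

Definition secant x k s := (enorm (chart x k s - x))^-1 *: (chart x k s - x).
(** For [x] on the rim, the unit right tangent of [chart x k] at 0, where the radius has value 1 and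
    slope [slope x k]. *)
Definition branch x k :=
  (enorm (slope x k *: x + k))^-1 *: (slope x k *: x + k).

Lemma branch_neq0 x k : dotp x k = 0 -> k != 0 -> slope x k *: x + k != 0.
Proof.
move=> xk k0; apply/eqP => /(congr1 (dotp k)).
rewrite !dotp_lin (dotpC k x) xk mulr0 add0r (dotpC k 0) dotp0l => /eqP.
by rewrite dotp_eq0 (negPf k0).
Qed.

(** For [s > 0] the secant has the direction of [sl s *: x + r *: k], where [r] is the radius,
    tending to 1, and [sl] is its difference quotient. *)
Lemma cvg_secant x k : rim x -> dotp x k = 0 -> k != 0 ->
  secant x k s @[s --> 0^'+] --> branch x k.
Proof.
move=> rx xk k0; have x0 := rim_neq0 _ rx; have N0 := dotp_ge0 x.
have id0 : s @[s --> (0 : R)^'+] --> 0 by exact: cvg_at_right_filter cvg_id.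
have a1 : rim_radius (x + s *: k) @[s --> 0^'+] --> (1 : R).
  by rewrite -(rim_radius1 _ rx); apply: cvg_rim_radius => //; exact: cvg_line.
pose sl s := (rim_radius (x + s *: k) - 1) / s.
pose rat s := (rim_radius (x + s *: k) * ((H (x + s *: k) - H x) / s) -
    rim_radius (x + s *: k) ^+ 2 * s * dotp k k) /
  (rim_radius (x + s *: k) * dotp x x + 1).
(* Factor [r - 1] out of the difference of the equations [|r z|^2 - H (r z) = 1]
   and [|x|^2 - H x = 1], where [z = x + s k]. *)
have slE s : 0 < s -> sl s = rat s.
  move=> s0; rewrite /sl /rat; have := chart_rim _ _ s x0 xk.
  have := rim_radius_gt0 _ (line_neq0 _ _ s x0 xk).
  rewrite /chart; move: (rim_radius _) => a a0; rewrite /rim /= excessZ ?ltW//.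
  rewrite !dotp_lin (dotpC k x) xk => e.
  have den : 0 < a * dotp x x + 1 by rewrite ltr_wpDl// mulr_ge0// ltW.
  move: rx; rewrite /rim /= /excess => rx.
  have -> : H x = dotp x x - 1 by rewrite -rx; ring.
  apply/eqP; rewrite eqr_div ?lt0r_neq0//; apply/eqP.
  move: e; move: (H _) => h e.
  have e' : a * h = a ^+ 2 * (dotp x x + s ^+ 2 * dotp k k) - 1.
    by rewrite -e; ring.
  transitivity ((a * h - a * (dotp x x - 1)) - a ^+ 2 * s ^+ 2 * dotp k k).
    by rewrite e'; ring.
  by field; rewrite lt0r_neq0.
have sl_cvg : sl s @[s --> 0^'+] --> slope x k.
  apply: (@cvg_trans _ (rat s @[s --> 0^'+])).
    by apply: near_eq_cvg; near=> s; rewrite -slE.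
  have DE : dotp x x + 1 = 1 * dotp x x + 1 by rewrite mul1r.
  rewrite /slope DE; apply: cvgM.
    rewrite -[X in _ --> X]subr0; apply: cvgB.
      rewrite -[X in _ --> X]mul1r; apply: cvgM => //; exact: dirder_cvg.
    rewrite -[X in _ --> X](mul0r (dotp k k)); apply: cvgM; last exact: cvg_cst.
    rewrite -[X in _ --> X](mulr0 (1 * 1)); apply: cvgM => //.
    by under eq_fun do rewrite expr2; exact: cvgM.
  apply: cvgV; first by rewrite mul1r lt0r_neq0//; lra.
  by apply: cvgD; [apply: cvgM => //|]; exact: cvg_cst.
apply: (@cvg_trans _ ((enorm (sl s *: x + rim_radius (x + s *: k) *: k))^-1 *:
   (sl s *: x + rim_radius (x + s *: k) *: k) @[s --> 0^'+])).
  apply: near_eq_cvg; near=> s; have s0 : 0 < s by [].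
  rewrite /secant.
  have -> : chart x k s - x = s *: (sl s *: x + rim_radius (x + s *: k) *: k).
    rewrite /chart /sl; move: (rim_radius _) => a.
    apply: rV2P; rewrite !mxE; field; exact: lt0r_neq0.
  rewrite enormZ gtr0_norm// scalerA invfM mulrAC mulVf ?mul1r//.
apply: cvg_normalize; first exact: branch_neq0.
apply: cvgD; first exact: cvgZr_tmp.
by rewrite -[X in _ --> X]scale1r; exact: cvgZr_tmp.
Unshelve. all: by end_near. Qed.

Lemma branch_tangential x k : rim x -> dotp x k = 0 -> k != 0 ->
  tangential_directions rim x (branch x k).
Proof.
move=> rx xk k0; have x0 := rim_neq0 _ rx.
have h0 : @harmonic R @ \oo --> (0 : R)^'+.
  apply: cvg_to_within; last exact: cvg_harmonic.
  by apply: nearW => n; exact: harmonic_gt0.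
split; first by apply: enorm_normalize; exact: branch_neq0.
exists (fun n => chart x k (harmonic n)); split.
- move=> n; split; first exact: chart_rim.
  by apply/eqP; apply: chart_neq => //; rewrite lt0r_neq0// invr_gt0.
- by apply: cvg_chart => //; exact: cvg_harmonic.
- exact: (cvg_comp _ _ h0 (cvg_secant _ _ rx xk k0)).
Unshelve. all: by end_near. Qed.

(** Near [x] the rim is the image of the chart, so a sequence tending to [x] amounts to parameters
    tending to 0. *)
Lemma tangential_rim x : rim x ->
  tangential_directions rim x = [set branch x (perp x); branch x (- perp x)].
Proof.
move=> rx; have x0 := rim_neq0 _ rx; have xp := dotp_perp x.
have p0 : perp x != 0 by rewrite perp_eq0.
have xN : dotp x (- perp x) = 0 by rewrite dotpNr xp oppr0.
have N0 : - perp x != 0 by rewrite oppr_eq0.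
apply/seteqP; split => w /=; last first.
  by move=> [->|->]; exact: branch_tangential.
move=> [w1 [y [yB yx yw]]].
set u1 := branch x (perp x); set u2 := branch x (- perp x).
(* Along a sequence whose normalized secants converge, the two sides of [x] may
   alternate; the product of the distances to the two branches tends to 0 from
   either side, so no subsequence has to be extracted. *)
pose phi s :=
  enorm (secant x (perp x) s - u1) * enorm (secant x (perp x) s - u2).
have c1 : secant x (perp x) s @[s --> 0^'+] --> u1 by exact: cvg_secant.
have c2 : secant x (perp x) s @[s --> 0^'-] --> u2.
  (* Changing [s] to [- s] turns the left limit into the right limit along [- perp x]. *)
  apply/cvg_at_leftNP; rewrite oppr0.
  have := cvg_secant x (- perp x) rx xN N0.
  by rewrite /secant /chart; under eq_fun do rewrite !scalerN -!scaleNr.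
have phi0 : phi s @[s --> 0^'] --> 0.
  apply: (@cvg_at_right_left_dnbhs _ R^o).
    rewrite -[X in _ --> X](mul0r (enorm (u1 - u2))) -[X in X * _]enorm0.
    rewrite -(subrr u1).
    by apply: cvgM; apply: cvg_enorm; apply: cvgB => //; exact: cvg_cst.
  rewrite -[X in _ --> X](mulr0 (enorm (u2 - u1))) -[X in _ * X]enorm0.
  rewrite -[X in _ * enorm X](subrr u2).
  by apply: cvgM; apply: cvg_enorm; apply: cvgB => //; exact: cvg_cst.
have xx0 : 0 < dotp x x by rewrite dotp_gt0.
(* The chart parameter of [y n], as the ratio of its coordinates along [perp x] and [x]. *)
pose f n := dotp (y n) (perp x) / dotp (y n) x.
have yx0 : \forall n \near \oo, 0 < dotp (y n) x.
  have yxx : dotp (y n) x @[n --> \oo] --> dotp x x.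
    by apply: cvg_dotp => //; exact: cvg_cst.
  exact: (cvgr_gt _ yxx).
have yE : \forall n \near \oo, y n = chart x (perp x) (f n).
  near=> n; have yn0 : 0 < dotp (y n) x by near: n.
  have E : y n = (dotp (y n) x / dotp x x) *: (x + f n *: perp x).
    apply: (@scalerI _ _ (dotp x x)); first by rewrite lt0r_neq0.
    rewrite perp_decomp scalerA mulrC divfK ?gt_eqF// scalerDr scalerA /f.
    by rewrite [_ * (_ / _)]mulrC divfK ?gt_eqF.
  rewrite {1}E; congr (_ *: _); apply/esym/rim_radiusE; first exact: divr_gt0.
  by rewrite -E; have [] := yB n.
have f0 : f n @[n --> \oo] --> (0 : R).
  rewrite -[X in _ --> X](mul0r (dotp x x)^-1) -xp.
  apply: cvgM; first by apply: cvg_dotp => //; exact: cvg_cst.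
  apply: cvgV; first by rewrite lt0r_neq0.
  by apply: cvg_dotp => //; exact: cvg_cst.
have f0' : f n @[n --> \oo] --> (0 : R)^'.
  apply: cvg_to_within f0; near=> n; apply/eqP => fn0; have [_] := yB n; apply.
  by rewrite (near yE n)// fn0 /chart scale0r addr0 rim_radius1// scale1r.
have lim0 := cvg_comp _ _ f0' phi0.
have lim1 : (phi \o f) n @[n --> \oo] --> enorm (w - u1) * enorm (w - u2).
  apply: (@cvg_trans _ (enorm ((enorm (y n - x))^-1 *: (y n - x) - u1) *
     enorm ((enorm (y n - x))^-1 *: (y n - x) - u2) @[n --> \oo])).
    apply: near_eq_cvg; near=> n.
    by rewrite /= /phi /secant -(near yE n).
  by apply: cvgM; apply: cvg_enorm; apply: cvgB => //; exact: cvg_cst.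
have /eqP : enorm (w - u1) * enorm (w - u2) = 0.
  exact: (cvg_unique (@Rhausdorff R) lim1 lim0).
by rewrite mulf_eq0 !enorm_eq0 !subr_eq0 => /orP[]/eqP->; [left|right].
Unshelve. all: by end_near. Qed.

(** * Density of wedges and absence of smooth arcs *)

Context (dv : dense_directions v).

(** Distinct rim points lie on distinct rays, and the bisector of the two rays separates them. *)
Lemma rim_separated z1 z2 : rim z1 -> rim z2 -> z1 != z2 ->
  exists n, dotp z1 (v n) < 0 /\ 0 < dotp z2 (v n).
Proof.
move=> r1 r2 z12; have n1 := rim_neq0 _ r1; have n2 := rim_neq0 _ r2.
have p1 : 0 < enorm z1 by rewrite enorm_gt0.
have p2 : 0 < enorm z2 by rewrite enorm_gt0.
(* [w] is normal to the bisector; [D] is the gap in Cauchy-Schwarz, positive because [dotp w w] is a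
   positive multiple of it. *)
pose w := enorm z1 *: z2 - enorm z2 *: z1.
pose D := enorm z1 * enorm z2 - dotp z1 z2.
have w0 : w != 0.
  apply: contra_neq z12 => /eqP; rewrite subr_eq0 => /eqP e.
  have E : z2 = (enorm z2 / enorm z1) *: z1.
    by rewrite mulrC -scalerA -e scalerA mulVf ?scale1r// lt0r_neq0.
  rewrite E (_ : _ / _ = 1) ?scale1r//; apply: (rim_ray_inj _ _ z1) => //.
  - exact: divr_gt0.
  - by rewrite -E.
  - by rewrite scale1r.
have wD : dotp w w = 2 * (enorm z1 * enorm z2) * D.
  rewrite /w /D !dotp_lin (dotpC z2 z1) -!enorm_sqr; ring.
have D0 : 0 < D.
  have : 0 < dotp w w by rewrite dotp_gt0.
  by rewrite wD pmulr_rgt0// mulr_gt0// mulr_gt0.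
apply: (dv _ _ w).
  have -> : dotp w z1 = - (enorm z1 * D).
    by rewrite /w /D !dotp_lin (dotpC z2 z1) -!enorm_sqr; ring.
  by rewrite oppr_lt0 mulr_gt0.
have -> : dotp w z2 = enorm z2 * D.
  by rewrite /w /D !dotp_lin -!enorm_sqr; ring.
by rewrite mulr_gt0.
Qed.

(** The jump at [x] of the derivative of the radius: a sum, because the second slope is taken in the
    opposite direction. *)
Definition kink x := slope x (perp x) + slope x (- perp x).

(** A nonzero [v n] cannot be orthogonal to both [x] and [perp x], so the bound in [slope_sum_ge] is
    positive. *)
Lemma kink_gt0 x n : x != 0 -> v n != 0 -> dotp x (v n) = 0 -> 0 < kink x.
Proof.
move=> x0 vn0 xn; apply: lt_le_trans (slope_sum_ge x (perp x) n xn).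
rewrite divr_gt0//; last by rewrite ltr_wpDl// dotp_ge0.
rewrite mulr_gt0// normr_gt0; apply/eqP => pn.
have := dotp_pythagoras x (v n); rewrite xn pn expr0n /= addr0 => /esym/eqP.
by rewrite mulf_eq0 !dotp_eq0 (negPf x0) (negPf vn0).
Qed.

(** The determinant of the two unit vectors is a nonzero multiple of [kink x], so by Lagrange's
    identity their product has square below 1. *)
Lemma branch_dotp x : rim x -> 0 < kink x ->
  -1 < dotp (branch x (perp x)) (branch x (- perp x)) < 1.
Proof.
move=> rx kx; have x0 := rim_neq0 _ rx; have xp := dotp_perp x.
have p0 : perp x != 0 by rewrite perp_eq0.
have b1 : slope x (perp x) *: x + perp x != 0 by exact: branch_neq0.
have b2 : slope x (- perp x) *: x + - perp x != 0.
  by apply: branch_neq0; rewrite ?oppr_eq0// dotpNr xp oppr0.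
have := dotp_pythagoras (branch x (perp x)) (branch x (- perp x)).
rewrite -!enorm_sqr !enorm_normalize// expr1n mulr1.
have : dotp (perp (branch x (perp x))) (branch x (- perp x)) != 0.
  have -> : dotp (perp (branch x (perp x))) (branch x (- perp x)) =
      - ((enorm (slope x (perp x) *: x + perp x))^-1 *
        (enorm (slope x (- perp x) *: x + - perp x))^-1 * (kink x * dotp x x)).
    rewrite /branch /kink.
    move: (slope x (perp x)) (slope x (- perp x)) => A1 A2.
    move: (enorm (A1 *: x + perp x))^-1 => c1.
    move: (enorm (A2 *: x + - perp x))^-1 => c2.
    by rewrite !dotpE !mxE /=; ring.
  by rewrite oppr_eq0 !mulf_neq0// ?invr_eq0 ?enorm_eq0 ?dotp_eq0// lt0r_neq0.
rewrite -sqrf_eq0 => d0 e.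
have d1 : 0 < dotp (perp (branch x (perp x))) (branch x (- perp x)) ^+ 2.
  by rewrite lt_neqAle eq_sym d0 sqr_ge0.
rewrite -ltr_norml -(@ltr_pXn2r _ 2)// ?nnegrE// expr1n real_normK ?num_real//.
by lra.
Qed.

Lemma rim_no_C1_curve (C : set 'rV[R]_2) : C `<=` rim -> ~ C1_curve C.
Proof.
move=> CB [I [g [dg [[Iitv [a [b [Ia Ib ab]]]] ginj gd [_ dg0] CE]]]].
have gB : g @` I `<=` rim by rewrite -CE.
have gab : g a != g b.
  by apply/eqP => /ginj e; move: ab; rewrite e ?ltxx// mem_set.
have rg t : I t -> rim (g t) by move=> It; apply: gB; exists t.
have [n [na nb]] := rim_separated _ _ (rg _ Ia) (rg _ Ib) gab.
have abI t : t \in `[a, b] -> I t.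
  by rewrite in_itv /= => tab; exact: Iitv Ia Ib _ tab.
have cont : {within `[a, b], continuous (fun t => dotp (g t) (v n))}.
  apply/subspace_continuousP => t /= tab.
  apply: cvg_dotp; last exact: cvg_cst.
  have D := diff_within_continuous _ _ _ _ (gd _ (abI _ tab)).
  move=> P /D DP; have {}DP : \forall s \near t, I s -> P (g s) := DP.
  suff : \forall s \near t, s \in `[a, b] -> P (g s) by [].
  by apply: filterS DP => s h sab; apply: h; exact: abI.
have [|c cab c0] := IVT (v := 0) (ltW ab) cont.
  by rewrite ge_min (ltW na)/= le_max (ltW nb) orbT.
have Ic := abI _ cab; set x := g c; have rx := rg _ Ic.
have x0 := rim_neq0 _ rx.
have kx : 0 < kink x.
  apply: (kink_gt0 _ n) => //.
  by apply: contraTneq na => ->; rewrite dotpC dotp0l ltxx.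
have tx := tangential_rim _ rx.
(* [g a] and [g b] are strictly off the line that contains [x], so [c] is interior. *)
have nI : exists2 r, 0 < r & forall s, `|s - c| <= r -> I s.
  have ac : a < c.
    move: cab; rewrite in_itv/= le_eqVlt => /andP[/predU1P[ca|//] _].
    by exfalso; move: na; rewrite ca c0 ltxx.
  have cb : c < b.
    move: cab; rewrite in_itv/= [c <= b]le_eqVlt => /andP[_ /predU1P[bc|//]].
    by exfalso; move: nb; rewrite -bc c0 ltxx.
  exists (Num.min (c - a) (b - c)); first by rewrite lt_min !subr_gt0 ac cb.
  move=> s; rewrite le_min !ler_norml => /andP[/andP[? ?] /andP[? ?]].
  by apply: abI; rewrite in_itv /=; apply/andP; split; lra.
have tg e : e ^+ 2 = 1 ->
    tangential_directions rim x (e *: ((enorm (dg c))^-1 *: dg c)).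
  by move=> e2; apply: curve_tangential ginj gB (dg0 _ Ic) (gd _ Ic) nI.
have sqN1 : (-1 : R) ^+ 2 = 1 by rewrite sqrrN expr1n.
have := tg 1 (expr1n _ _); have := tg (-1) sqN1.
rewrite scale1r scaleN1r tx; set d := _ *: dg c => dN dP.
have d1 : dotp d d = 1.
  by rewrite -enorm_sqr enorm_normalize ?expr1n//; exact: dg0.
clearbody d; have := branch_dotp _ rx kx; move: dN dP => /=.
have dNd : - d = d -> False.
  by move=> /(congr1 (dotp d)); rewrite dotpNr d1; lra.
(* [d] and [- d] differ, so they would be the two branches, with product -1 against
   [branch_dotp]. *)
move=> [eN|eN] [eP|eP].
- by case: dNd; rewrite eN eP.
- by rewrite -eN -eP !dotp_lin d1; lra.
- by rewrite -eN -eP !dotp_lin d1; lra.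
- by case: dNd; rewrite eN eP.
Qed.

Lemma rim_singularity x : rim x -> singularity rim x.
Proof.
move=> rx; split => // -[_ [delta [_ [C [C1 CE]]]]].
by apply: (rim_no_C1_curve C) => //; rewrite CE => y [].
Qed.

Lemma rim_wedge x : rim x -> 0 < kink x -> wedge rim x.
Proof.
move=> rx kx; split; first exact: rim_singularity.
have x0 := rim_neq0 _ rx; have xp := dotp_perp x.
have p0 : perp x != 0 by rewrite perp_eq0.
have b1 : slope x (perp x) *: x + perp x != 0 by exact: branch_neq0.
have b2 : slope x (- perp x) *: x + - perp x != 0.
  by apply: branch_neq0; rewrite ?oppr_eq0// dotpNr xp oppr0.
have e1 : enorm (branch x (perp x)) = 1 by exact: enorm_normalize.
have e2 : enorm (branch x (- perp x)) = 1 by exact: enorm_normalize.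
have /andP[dm dM] := branch_dotp _ rx kx.
exists (branch x (perp x)), (branch x (- perp x)); split.
- apply/eqP => e; move: dM.
  by rewrite e -enorm_sqr e2 expr1n ltxx.
- exact: tangential_rim.
- rewrite /angle e1 e2 mulr1 divr1.
  by rewrite acos_gt0 ?acos_ltpi// ?dm ?dM ?(ltW dm) ?(ltW dM).
Qed.

(** The chart between two parameters close to 0 crosses a line orthogonal to some [v n], and does so
    at a wedge. *)
Lemma rim_limit_wedge x : rim x -> limit_point [set y | wedge rim y] x.
Proof.
move=> rx U Ux; have x0 := rim_neq0 _ rx; have xp := dotp_perp x.
have p0 : perp x != 0 by rewrite perp_eq0.
have : chart x (perp x) s @[s --> (0 : R)^'+] --> x.
  by apply: cvg_chart => //; exact: cvg_at_right_filter cvg_id.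
move=> /(_ _ Ux)[r /= r0 rU].
(* Any two distinct positive parameters below [r] would do. *)
pose s1 := r / 3; pose s2 := r / 2.
have ch_rim s : rim (chart x (perp x) s) by exact: chart_rim.
have line0 s : x + s *: perp x != 0 by exact: line_neq0.
have ch_dot s k : dotp (chart x (perp x) s) k =
    rim_radius (x + s *: perp x) * (dotp x k + s * dotp (perp x) k).
  by rewrite /chart !dotp_lin.
have s12 : chart x (perp x) s1 != chart x (perp x) s2.
  apply/eqP => e.
  have := congr1 (fun z => dotp z x) e.
  have := congr1 (fun z => dotp z (perp x)) e.
  rewrite !ch_dot xp dotp_perp2 (dotpC (perp x)) xp !mulr0 !addr0 !add0r !mulrA.
  have xx0 : dotp x x != 0 by rewrite dotp_eq0.
  move=> /(mulIf xx0) e1 /(mulIf xx0) e2; move: e1; rewrite e2.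
  by have := mulr_gt0 (rim_radius_gt0 _ (line0 s2)) r0; lra.
have [n [n1 n2]] := rim_separated _ _ (ch_rim s1) (ch_rim s2) s12.
move: n1 n2; rewrite !ch_dot (pmulr_rlt0 _ (rim_radius_gt0 _ (line0 s1))).
rewrite (pmulr_rgt0 _ (rim_radius_gt0 _ (line0 s2))).
set p := dotp x (v n); set q := dotp (perp x) (v n) => n1 n2.
have s21 : 0 < s2 - s1 by rewrite /s1 /s2; lra.
have q0 : 0 < q by rewrite -(pmulr_rgt0 _ s21) mulrBl; lra.
have sq : - p / q * q = - p by rewrite divfK// lt0r_neq0.
(* [p + s * q] is negative at [s1] and positive at [s2], so its root lies between. *)
have s_gt : s1 < - p / q by rewrite ltr_pdivlMr//; lra.
have s_lt : - p / q < s2 by rewrite ltr_pdivrMr//; lra.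
move: (- p / q) sq s_gt s_lt => s sq s_gt s_lt.
have s0 : 0 < s by rewrite /s1 in s_gt; lra.
exists (chart x (perp x) s); split.
- by apply: chart_neq => //; exact: lt0r_neq0.
- apply: rim_wedge => //; apply: (kink_gt0 _ n).
  + exact: rim_neq0.
  + by apply: contraTneq q0 => vn0; rewrite /q vn0 dotpC dotp0l ltxx.
  + by rewrite ch_dot -/p -/q sq subrr mulr0.
- apply: rU => //=; rewrite sub0r normrN gtr0_norm//.
  by rewrite /s2 in s_lt; lra.
Qed.

(** Without a kink the two slopes are opposite, and so are the two branches. *)
Lemma rim_wedge_or_shallow x :
  rim x -> wedge rim x \/ shallow_singularity rim x.
Proof.
move=> rx; have := slope_sum_ge0 x (perp x); rewrite -/(kink x) le_eqVlt.
move=> /predU1P[k0|kx]; [right|left; exact: rim_wedge].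
split; [exact: rim_singularity| |exact: rim_limit_wedge].
exists (branch x (perp x)); rewrite tangential_rim//; congr [set _; _].
have E : slope x (- perp x) = - slope x (perp x).
  by apply/eqP; rewrite -addr_eq0 addrC -/(kink x) -k0.
by rewrite /branch E scaleNr -opprD enormN scalerN.
Qed.

End body.

Theorem theorem1 (R : realType) :
  exists (E : set 'rV[R]_2) (eps : R),
    [/\ E !=set0, compact E, 0 < eps,
        forall x : 'rV[R]_2, boundary (eps_neighbourhood E eps) x ->
          wedge (boundary (eps_neighbourhood E eps)) x \/
          shallow_singularity (boundary (eps_neighbourhood E eps)) x
      & forall C : set 'rV[R]_2, C `<=` boundary (eps_neighbourhood E eps) ->
          ~ C1_curve C].
Proof.
have [v [vs vd]] := @dense_directionsP R; have HP := gaugeP v vs.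
have [E [E0 Ec EK]] := body_is_neighbourhood HP.
exists E, 1; rewrite EK (boundary_body HP); split => //.
- exact: (rim_wedge_or_shallow HP vd).
- exact: (rim_no_C1_curve HP vd).
Qed.
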